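(* If a minimally self-adjusting BST algorithm $\mathcal{A}$ satisfies the access lemma via the SOL potential, then $\mathcal{A}$ is local.
   Context: Keys are $[n]=\{1,\dots,n\}$. For a BST $T$ and node $a$, $T(a)$ is the set of keys in the subtree rooted at $a$. A weight function is $w:[n]\to\mathbb{R}_{>0}$, $w(S)=\sum_{a\in S}w(a)$, $W=w([n])$, and the SOL potential is $\Phi_T=\sum_{a\in[n]}\log_2 w(T(a))$. A minimally self-adjusting BST algorithm: when key $s$ is accessed in the current tree $T$, with search path $P$ (nodes on the root-to-$s$ path, including $s$; called the before-path), it replaces $P$ by a BST $A$ on the node set $P$ with root $s$ (the after-tree), reattaching the subtrees hanging off $P$ in the unique order-consistent way, giving $T'$; the cost is $|P|$. It satisfies the access lemma via the SOL potential if there is a constant $c'$ such that always $|P|\le\Phi_T-\Phi_{T'}+c'(1+\log_2\frac{W}{w(s)})$ (for all $n$, $T$, $w$, $s$ and all $T'$ the algorithm can produce). A decomposition of a transformation $P\to A$ is a sequence of BSTs $P=Q_0,Q_1,\dots,Q_k=A$ such that for each $i$, $Q_{i+1}$ is obtained from $Q_i$ by rearranging a path $P_i$ contained in $Q_i$ (a set of nodes forming a downward path in $Q_i$) into a BST $T_i$ on the same nodes and reattaching all the attached subtrees in the unique way given by the key order. It is local with window-size $w$ if: (start) $s\in P_0$; (progress) $P_{i+1}\setminus P_i\neq\emptyset$ for all $i$; (overlap) $P_{i+1}\cap P_i\ne\emptyset$ for all $i$; (no-revisit) $(P_i\setminus P_{i+1})\cap P_j=\emptyset$ for all $j>i+1$;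 (window-size) $|P_i|\le w$ for all $i$. The algorithm is local if there is a constant $w$ such that every before-path $\to$ after-tree transformation it performs has a local decomposition with window-size $w$. *)

(* Defs.v *)
From mathcomp Require Import all_boot all_order all_algebra.
From mathcomp Require Import reals exp.

Set Implicit Arguments.
Unset Strict Implicit.
Unset Printing Implicit Defensive.

Import Order.TTheory GRing.Theory Num.Theory.
Local Open Scope ring_scope.

(* The n keys are the ordinals 'I_n, i.e. {0, ..., n-1} instead of
   {1, ..., n}; nodes are identified with their keys. *)
Inductive tree (n : nat) : Type :=
| Leaf
| Node of tree n & 'I_n & tree n.

Arguments Leaf {n}.
Arguments Node {n}.

Fixpoint keys n (T : tree n) : {set 'I_n} :=
  if T is Node l k r then k |: (keys l :|: keys r) else set0.

Fixpoint bst n (T : tree n) : Prop :=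
  if T is Node l k r then
    [/\ (forall a, a \in keys l -> (a < k)%N),
        (forall a, a \in keys r -> (k < a)%N), bst l & bst r]
  else True.

Definition bst_on n (P : {set 'I_n}) (T : tree n) : Prop :=
  bst T /\ keys T = P.

Definition root n (T : tree n) : option 'I_n :=
  if T is Node _ k _ then Some k else None.

Fixpoint subtree n (T : tree n) (a : 'I_n) : tree n :=
  if T is Node l k r then
    if a == k then T else if (a < k)%N then subtree l a else subtree r a
  else Leaf.

(* The search path to s in T, itself viewed as a BST; its set of nodes is
   keys (before_path T s). *)
Fixpoint before_path n (T : tree n) (s : 'I_n) : tree n :=
  if T is Node l k r then
    if s == k then Node Leaf k Leaf
    else if (s < k)%N then Node (before_path l s) k Leaf
    else Node Leaf k (before_path r s)
  else Leaf.

(* The sequence q lists, from top to bottom, the nodes of a downward path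
   of T starting at its root. *)
Fixpoint root_path n (T : tree n) (q : seq 'I_n) : bool :=
  match T, q with
  | Node l k r, a :: q' =>
      (a == k) && [|| nilp q', root_path l q' | root_path r q']
  | _, _ => false
  end.

Fixpoint down_path n (T : tree n) (q : seq 'I_n) : bool :=
  root_path T q ||
  (if T is Node l _ r then down_path l q || down_path r q else false).

Definition is_path n (T : tree n) (P : {set 'I_n}) : Prop :=
  exists2 q : seq 'I_n, down_path T q & P = [set a in q].

(* Subtrees (possibly empty) hanging off the nodes of P in T, in increasing
   key order, when P is a connected set of nodes containing the root of T. *)
Fixpoint hanging n (P : {set 'I_n}) (T : tree n) : seq (tree n) :=
  if T is Node l k r then
    if k \in P then hanging P l ++ hanging P r else [:: T]
  else [:: Leaf].

Fixpoint nb_leaves n (T : tree n) : nat :=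
  if T is Node l _ r then (nb_leaves l + nb_leaves r)%N else 1%N.

(* Replaces the empty subtrees of A, from left to right, by the trees of ts. *)
Fixpoint fill n (A : tree n) (ts : seq (tree n)) : tree n :=
  if A is Node l k r then
    Node (fill l (take (nb_leaves l) ts)) k (fill r (drop (nb_leaves l) ts))
  else head Leaf ts.

(* Replaces, in T, the downward path with node set P by the tree A on P, and
   reattaches the hanging subtrees at the positions imposed by the key order:
   both the |P|+1 hanging subtrees and the |P|+1 free positions of A are
   ordered from left to right. The second branch looks for the topmost node
   of P. *)
Fixpoint rearrange n (P : {set 'I_n}) (A T : tree n) : tree n :=
  if T is Node l k r then
    if k \in P then fill A (hanging P T)
    else Node (rearrange P A l) k (rearrange P A r)
  else Leaf.

(* [step T s A] means that, when s is accessed in the current tree T, the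
   algorithm may replace the search path by the after-tree A. A relation is
   used since the choice of A need not be a function of T and s. *)
Record msa_algorithm : Type := MsaAlgorithm {
  step :> forall n : nat, tree n -> 'I_n -> tree n -> Prop;
  step_total : forall (n : nat) (T : tree n) (s : 'I_n),
    bst_on [set: 'I_n] T -> exists A, step T s A;
  step_after_tree : forall (n : nat) (T : tree n) (s : 'I_n) (A : tree n),
    bst_on [set: 'I_n] T -> step T s A ->
    bst_on (keys (before_path T s)) A /\ root A = Some s
}.

Definition new_tree n (T : tree n) (s : 'I_n) (A : tree n) : tree n :=
  rearrange (keys (before_path T s)) A T.

Section SOL.
Variable R : realType.

Definition log2 (x : R) : R := ln x / ln 2.

Definition weight n (w : 'I_n -> R) (S : {set 'I_n}) : R :=
  \sum_(a in S) w a.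

Definition sol_potential n (w : 'I_n -> R) (T : tree n) : R :=
  \sum_(a : 'I_n) log2 (weight w (keys (subtree T a))).

Definition access_lemma (alg : msa_algorithm) : Prop :=
  exists c : R, forall (n : nat) (T : tree n) (w : 'I_n -> R) (s : 'I_n)
      (A : tree n),
    bst_on [set: 'I_n] T -> (forall a, 0 < w a) -> alg n T s A ->
    #|keys (before_path T s)|%:R <=
      sol_potential w T - sol_potential w (new_tree T s A)
      + c * (1 + log2 (weight w [set: 'I_n] / w s)).

End SOL.

Definition path_rearrangement n (P : {set 'I_n}) (Q Q' : tree n) : Prop :=
  is_path Q P /\ exists2 B : tree n, bst_on P B & Q' = rearrange P B Q.

(* Decomposition Q 0 = P, ..., Q k = A, in which Q i.+1 is obtained from Q i by
   rearranging the path p i; only the values Q i for i <= k and p i for i < k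
   are relevant. The paths are p 0, ..., p k.-1, and p 0 must exist. *)
Definition local_decomposition n (m : nat) (s : 'I_n) (P A : tree n) : Prop :=
  exists (k : nat) (Q : nat -> tree n) (p : nat -> {set 'I_n}),
    [/\ (0 < k)%N, Q 0%N = P, Q k = A
      & forall i, (i < k)%N -> path_rearrangement (p i) (Q i) (Q i.+1)] /\
    [/\ s \in p 0%N,
        (forall i, (i.+1 < k)%N -> p i.+1 :\: p i != set0),
        (forall i, (i.+1 < k)%N -> p i.+1 :&: p i != set0),
        (forall i j, (i.+1 < j)%N -> (j < k)%N ->
           (p i :\: p i.+1) :&: p j = set0)
      & forall i, (i < k)%N -> (#|p i| <= m)%N].

Definition local (alg : msa_algorithm) : Prop :=
  exists m : nat, forall (n : nat) (T : tree n) (s : 'I_n) (A : tree n),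
    bst_on [set: 'I_n] T -> alg n T s A ->
    local_decomposition m s (before_path T s) A.

(* Main.v *)
Require Import Defs.
From mathcomp Require Import all_boot all_order all_algebra.
From mathcomp Require Import reals sequences exp.
From mathcomp Require Import zify lra.

(* Give weight 1 to the keys of a set C containing s and closed under taking
   subtrees in T, and a huge weight N to the other keys. When log N tends to
   infinity, the access lemma bounds by a constant the number of v in C whose
   subtree in the after-tree A leaves C: the potential of each of them increases
   by at least log N - log n, that of any other node decreases by at most log n,
   and log (W / w(s)) is at most log (n N).

   The decomposition moves the window up the search path. When only a prefix U
   of the path remains to be visited, the current tree consists of the path
   made of the v that have, in A, a descendant in U, followed by s; below this
   path, between two consecutive keys, hangs the restriction of A to the keys
   in between. When the last node x of U is visited, the window consists of s
   and of the nodes from x down to s that have in A a descendant in U. Apart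
   from x, the nodes of the window are below x in T but have in A a descendant
   which is not, so that the bound applies to the keys C of T below x. *)

Set Implicit Arguments.
Unset Strict Implicit.
Unset Printing Implicit Defensive.

Import Order.TTheory GRing.Theory Num.Theory.

(** * Search trees: subtrees, in-order traversal, reattachment, search paths *)

Section Trees.
Variable n : nat.
Implicit Types (T A B l r : tree n) (k v s : 'I_n) (W : {set 'I_n}).

Lemma in_keys_node l k r v :
  (v \in keys (Node l k r)) = [|| v == k, v \in keys l | v \in keys r].
Proof. by rewrite /= !inE. Qed.

Lemma keys_eq0 T : keys T = set0 -> T = Leaf.
Proof.
by case: T => // l k r /setP/(_ k); rewrite in_keys_node eqxx inE.
Qed.

Lemma subtree_node_lt l k r v :
  (v < k)%N -> subtree (Node l k r) v = subtree l v.
Proof. by move=> vk; rewrite /= vk -val_eqE (ltn_eqF vk). Qed.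

Lemma subtree_node_gt l k r v :
  (k < v)%N -> subtree (Node l k r) v = subtree r v.
Proof. by move=> kv; rewrite /= -val_eqE (gtn_eqF kv) ltnNge (ltnW kv). Qed.

Lemma subtree_node_eq l k r : subtree (Node l k r) k = Node l k r.
Proof. by rewrite /= eqxx. Qed.

Lemma keys_subtree_sub T v : keys (subtree T v) \subset keys T.
Proof.
elim: T => [|l IHl k r IHr] /=; first exact: sub0set.
case: ifP => // _; case: ifP => _.
  apply: (subset_trans IHl); rewrite setUCA subsetUl //.
by apply: (subset_trans IHr); rewrite setUA subsetUr.
Qed.

Lemma mem_keys_subtree T v :
  bst T -> v \in keys T -> v \in keys (subtree T v).
Proof.
elim: T => [|l IHl k r IHr] //=; rewrite !inE => -[lk kr bl br].
case: eqVneq => [->|/= nvk] /=; first by rewrite !inE eqxx.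
by case/orP=> vT; [rewrite lk // IHl | rewrite ltnNge ltnW ?kr //= IHr].
Qed.

Lemma mem_keys_subtree_trans T v d e :
  bst T -> d \in keys (subtree T v) -> e \in keys (subtree T d) ->
  e \in keys (subtree T v).
Proof.
elim: T => [|l IHl k r IHr] // [lk kr bl br].
have [vk|kv|/val_inj ->] := ltngtP v k.
- rewrite (subtree_node_lt _ _ vk) => dv.
  have dk := lk _ (subsetP (keys_subtree_sub _ _) _ dv).
  by rewrite (subtree_node_lt _ _ dk); apply: IHl.
- rewrite (subtree_node_gt _ _ kv) => dv.
  have dk := kr _ (subsetP (keys_subtree_sub _ _) _ dv).
  by rewrite (subtree_node_gt _ _ dk); apply: IHr.
by rewrite subtree_node_eq => _; apply/subsetP/keys_subtree_sub.
Qed.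

Fixpoint inorder T : seq 'I_n :=
  if T is Node l k r then inorder l ++ k :: inorder r else [::].

Lemma mem_inorder T : inorder T =i keys T.
Proof.
elim: T => [|l IHl k r IHr] v /=; first by rewrite inE.
by rewrite mem_cat !inE IHl IHr orbCA.
Qed.

(** This turns the order conditions into sortedness of one sequence, which rearranging a tree leaves
    unchanged. *)
Lemma bst_inorderP T :
  bst T <-> pairwise (fun i j : 'I_n => (i < j)%N) (inorder T).
Proof.
elim: T => [|l IHl k r IHr] //=; rewrite pairwise_cat /=; split.
  case=> lk kr /IHl -> /IHr ->; rewrite !andbT; apply/andP; split; last first.
    by apply/allP => v; rewrite mem_inorder => /kr.
  apply/allrelP => u v; rewrite mem_inorder inE => /lk uk /orP[/eqP-> //|].
  by rewrite mem_inorder => /kr; apply: ltn_trans.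
case/and4P=> /allrelP lkr /IHl bl /allP kr /IHr br; split=> // v vT.
  by apply: lkr; rewrite ?mem_inorder ?inE ?eqxx.
by apply: kr; rewrite mem_inorder.
Qed.

Lemma eq_inorder T T' :
  bst T -> bst T' -> keys T = keys T' -> inorder T = inorder T'.
Proof.
move=> /bst_inorderP bT /bst_inorderP bT' eTT'.
have tr : transitive (fun i j : 'I_n => (i < j)%N).
  by move=> j i k; apply: ltn_trans.
apply: (irr_sorted_eq tr) => [i|||v]; rewrite ?ltnn ?(sorted_pairwise tr) //.
by rewrite !mem_inorder eTT'.
Qed.

(** Stated on sequences so that the in-order traversal of [fill A ts] visibly depends on [A] only
    through [inorder A]. A missing tree counts as [Leaf]. *)
Fixpoint weave (ks : seq 'I_n) (ts : seq (tree n)) : seq 'I_n :=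
  if ks is k :: ks' then inorder (head Leaf ts) ++ k :: weave ks' (behead ts)
  else inorder (head Leaf ts).

Lemma weave_cat ks k ks' ts :
  weave (ks ++ k :: ks') ts =
  weave ks (take (size ks).+1 ts) ++ k :: weave ks' (drop (size ks).+1 ts).
Proof.
by elim: ks ts => [|h ks IH] [|t ts] //=; rewrite ?take0 ?drop0 ?IH -?catA.
Qed.

Lemma nb_leavesE T : nb_leaves T = (size (inorder T)).+1.
Proof.
by elim: T => //= l -> k r ->; rewrite size_cat.
Qed.

Lemma inorder_fill A ts : inorder (fill A ts) = weave (inorder A) ts.
Proof.
by elim: A ts => //= l IHl k r IHr ts; rewrite IHl IHr weave_cat nb_leavesE.
Qed.

Lemma keys_sub_fill A ts : keys A \subset keys (fill A ts).
Proof.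
elim: A ts => [|l IHl k r IHr] ts /=; first exact: sub0set.
by rewrite !setUS // setUSS.
Qed.

(** Hence a node whose subtree in the after-tree leaves some set of keys still does so in the new
    tree. *)
Lemma keys_subtree_fill A ts v :
  keys (subtree A v) \subset keys (subtree (fill A ts) v).
Proof.
elim: A ts => [|l IHl k r IHr] ts /=; first exact: sub0set.
case: ifP => _; first exact: (@keys_sub_fill (Node l k r)).
by case: ifP.
Qed.

(** Complement of [hanging W T]: the two cut [T] below the connected part of [W] at the root, and
    [fill] glues them back. *)
Fixpoint top W T : tree n :=
  if T is Node l k r then
    if k \in W then Node (top W l) k (top W r) else Leaf
  else Leaf.

Lemma size_hanging W T : size (hanging W T) = nb_leaves (top W T).
Proof.
by elim: T => //= l IHl k r IHr; case: ifP => //= _; rewrite size_cat IHl IHr.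
Qed.

Lemma fill_top W T : fill (top W T) (hanging W T) = T.
Proof.
elim: T => //= l IHl k r IHr; case: ifP => //= _.
by rewrite -size_hanging take_size_cat // drop_size_cat // IHl IHr.
Qed.

Lemma keys_before_path_sub T s : keys (before_path T s) \subset keys T.
Proof.
elim: T => [|l IHl k r IHr] //=; case: ifP => _.
  by rewrite /= setU0 setU0 subsetUl.
by case: ifP => _ /=; rewrite setUS // setUSS // sub0set.
Qed.

(** A subtree off the path misses [W], so its top part is empty. [W] is compared with the path on
    the keys of [T] only, so that the same [W] serves in the induction on subtrees. *)
Lemma top_before_path T s W :
  bst T -> s \in keys T ->
  {in keys T, forall v, (v \in W) = (v \in keys (before_path T s))} ->
  top W T = before_path T s.
Proof.
have top0 T' : {in keys T', forall v, v \notin W} -> top W T' = Leaf.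
  case: T' => //= l' k' r' H.
  by rewrite (negbTE (H k' _)) // !inE eqxx.
elim: T => // l IHl k r IHr /= [lk kr bl br] sT H.
have kW : k \in W.
  rewrite H ?inE ?eqxx //.
  by case: ifP => _; [|case: ifP => _]; rewrite /= !inE eqxx.
have neqk v : v \in keys l \/ v \in keys r -> (v == k) = false.
  by rewrite -val_eqE; case=> [/lk|/kr] vk; [rewrite ltn_eqF|rewrite gtn_eqF].
have inT v : v \in keys l \/ v \in keys r ->
    v \in k |: (keys l :|: keys r).
  by rewrite !inE; case=> ->; rewrite ?orbT.
rewrite kW; case: eqVneq sT H => [-> _ HW|nsk sT].
  by rewrite !top0 // => v vT; rewrite HW ?inT ?inE ?neqk; auto.
have [sk|ks|/val_inj/eqP] := ltngtP s k; last by rewrite (negbTE nsk).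
- have sl : s \in keys l.
    by move: sT; rewrite !inE (negbTE nsk) /= => /orP[//|/kr]; lia.
  move=> HW; rewrite IHl // => [|v vl].
    rewrite top0 // => v vr; rewrite HW ?inT /= ?inE ?neqk; auto.
    rewrite orbF; apply/negP => /(subsetP (keys_before_path_sub _ _)) /lk.
    by move/kr: vr; lia.
  by rewrite HW ?inT /= ?inE ?neqk ?orbF; auto.
have sr : s \in keys r.
  by move: sT; rewrite !inE (negbTE nsk) /= => /orP[/lk|//]; lia.
move=> HW; rewrite (IHr br sr) // => [|v vr].
  rewrite top0 // => v vl; rewrite HW ?inT /= ?inE ?neqk; auto.
  apply/negP => /(subsetP (keys_before_path_sub _ _)) /kr.
  by move/lk: vl; lia.
by rewrite HW ?inT /= ?inE ?neqk; auto.
Qed.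

Lemma rearrange_root W B T k : Defs.root T = Some k -> k \in W ->
  rearrange W B T = fill B (hanging W T).
Proof. by case: T => //= l k' r [->] kW; rewrite kW. Qed.

Lemma root_before_path T s : Defs.root (before_path T s) = Defs.root T.
Proof. by case: T => //= l k r; do 2?case: ifP => //. Qed.

Lemma root_keys T k : Defs.root T = Some k -> k \in keys T.
Proof. by case: T => //= l k' r [->]; rewrite !inE eqxx. Qed.

Lemma new_treeE T s A : s \in keys T ->
  new_tree T s A = fill A (hanging (keys (before_path T s)) T).
Proof.
move=> sT; case eT: (Defs.root T) => [k|]; last first.
  by case: T sT eT => //=; rewrite inE.
by apply: (rearrange_root _ eT); rewrite root_keys ?root_before_path.
Qed.

Lemma bst_before_path T s : bst T -> bst (before_path T s).
Proof.
elim: T => //= l IHl k r IHr [lk kr bl br].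
case: ifP => _ /=; first by split => // v; rewrite inE.
case: ifP => _ /=; split; auto=> v; rewrite ?inE //.
  by move/(subsetP (keys_before_path_sub _ _)); apply: lk.
by move/(subsetP (keys_before_path_sub _ _)); apply: kr.
Qed.

(** The before-path and [A] are BSTs on the same keys, hence have the same in-order sequence.
    Filling both with the same hanging trees then gives the same in-order sequence, that of [T]. *)
Lemma new_tree_bst T s A :
  bst T -> s \in keys T -> bst_on (keys (before_path T s)) A ->
  bst_on (keys T) (new_tree T s A).
Proof.
move=> bT sT [bA kA].
have e : inorder (new_tree T s A) = inorder T.
  rewrite new_treeE // inorder_fill (eq_inorder bA (bst_before_path s bT) kA).
  rewrite -{1}(top_before_path bT sT (fun _ _ => erefl)).
  by rewrite -inorder_fill fill_top.
split; first by apply/bst_inorderP; rewrite e; apply/bst_inorderP.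
by apply/setP => v; rewrite -!mem_inorder e.
Qed.

(** The endpoint [s] is left out: it belongs to every window and is treated apart. *)
Fixpoint search_path T s : seq 'I_n :=
  if T is Node l k r then
    if s == k then [::]
    else if (s < k)%N then k :: search_path l s
    else k :: search_path r s
  else [::].

Lemma keys_before_path T s : s \in keys T ->
  bst T -> keys (before_path T s) = s |: [set v in search_path T s].
Proof.
elim: T => [|l IHl k r IHr] /=; first by rewrite inE.
rewrite !inE => sT [lk kr bl br]; apply/setP => v.
case: eqVneq sT => [->|nsk] sT /=; first by rewrite !inE orbF.
have [sk|ks|/val_inj/eqP] := ltngtP s k; last by rewrite (negbTE nsk).
  rewrite in_keys_node IHl ?inE //; first by rewrite orbF orbCA.
  by move: sT => /= /orP[//|/kr]; lia.
rewrite in_keys_node IHr ?inE //=; first by rewrite orbCA.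
by move: sT => /= /orP[/lk|//]; lia.
Qed.

(** [C] is the key set of the subtree of [T] reached after [j] steps towards [s]: the first [j]
    nodes of the path are above it, the others inside. *)
Lemma search_path_cut T s j :
  bst T -> s \in keys T -> (j <= size (search_path T s))%N ->
  exists C : {set 'I_n},
    [/\ C \subset keys T, s \in C,
        {in C, forall v, keys (subtree T v) \subset C},
        {in take j (search_path T s), forall v, v \notin C}
      & {in drop j (search_path T s), forall v, v \in C}].
Proof.
elim: T j => [|l IHl k r IHr] j; first by rewrite inE.
case: j => [|j] bT sT.
  move=> _; exists (keys (Node l k r)); rewrite drop0 take0; split => //.
    by move=> v _; exact: keys_subtree_sub.
  move=> v vp; have: v \in keys (before_path (Node l k r) s).
    by rewrite (keys_before_path sT bT) inE [X in _ || X]inE vp orbT.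
  exact/subsetP/keys_before_path_sub.
move: (bT) => [lk kr bl br]; move: sT; rewrite in_keys_node [search_path _ _]/=.
case: eqVneq => //= nsk.
have [sk|ks|/val_inj/eqP] := ltngtP s k; last by rewrite (negbTE nsk).
  move=> sT; have {}sT: s \in keys l by case/orP: sT => // /kr; lia.
  rewrite /= ltnS => /(IHl _ bl sT)[C [Cl sC cC tC dC]]; exists C; split=> //.
  - by apply: (subset_trans Cl); rewrite setUCA subsetUl.
  - move=> v vC; rewrite -/(subtree (Node l k r) v) subtree_node_lt ?cC //.
    exact/lk/(subsetP Cl).
  - move=> v; rewrite inE => /predU1P[->|/tC //].
    by apply/negP => /(subsetP Cl)/lk; rewrite ltnn.
move=> sT; have {}sT: s \in keys r by case/orP: sT => // /lk; lia.
rewrite /= ltnS => /(IHr _ br sT)[C [Cl sC cC tC dC]]; exists C; split=> //.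
- by apply: (subset_trans Cl); rewrite setUA subsetUr.
- move=> v vC; rewrite -/(subtree (Node l k r) v) subtree_node_gt ?cC //.
  exact/kr/(subsetP Cl).
- move=> v; rewrite inE => /predU1P[->|/tC //].
  by apply/negP => /(subsetP Cl)/kr; rewrite ltnn.
Qed.

End Trees.

(** * Restrictions of a search tree to key intervals *)

Section Local.
Variable n : nat.
Implicit Types (T l r : tree n) (k v x y : 'I_n) (W : {set 'I_n})
  (a b lo hi : nat) (p q U : seq 'I_n).

(* The restriction of a BST to the keys of [a, b); the bounds are naturals, so
   that [0] and [n] stand for the absence of a bound. *)
Fixpoint restrict a b T : tree n :=
  if T is Node l k r then
    if (k < a)%N then restrict a b r
    else if (b <= k)%N then restrict a b l
    else Node (restrict a b l) k (restrict a b r)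
  else Leaf.

Lemma keys_restrict_sub a b T : keys (restrict a b T) \subset keys T.
Proof.
elim: T => [|l IHl k r IHr] /=; first exact: sub0set.
case: ifP => _; first by rewrite (subset_trans IHr) // setUA subsetUr.
case: ifP => _; first by rewrite (subset_trans IHl) // setUCA subsetUl.
by rewrite /= setUS // setUSS.
Qed.

Lemma keys_restrict_bounds a b T v :
  v \in keys (restrict a b T) -> (a <= v < b)%N.
Proof.
elim: T => [|l IHl k r IHr] /=; first by rewrite inE.
case: (ltnP k a) => // ak; case: (leqP b k) => // kb.
by rewrite in_keys_node => /or3P[/eqP->||] //; rewrite ak.
Qed.

Lemma restrict_id a b T :
  {in keys T, forall v, (a <= v < b)%N} -> restrict a b T = T.
Proof.
elim: T => //= l IHl k r IHr H.
have /andP[ak kb] : (a <= k < b)%N by apply: H; rewrite !inE eqxx.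
by rewrite ltnNge ak leqNgt kb /= IHl ?IHr // => v vT;
  apply: H; rewrite !inE vT ?orbT.
Qed.

Lemma mem_keys_restrict a b T v :
  bst T -> v \in keys T -> (a <= v < b)%N -> v \in keys (restrict a b T).
Proof.
elim: T => //= l IHl k r IHr [lk kr bl br]; rewrite !inE => vT avb.
case: (ltnP k a) => [ka|ak].
  apply: IHr => //; case/or3P: vT => // [/eqP e|/lk]; last by lia.
  by move: avb; rewrite e; lia.
case: (leqP b k) => [bk|kb].
  apply: IHl => //; case/or3P: vT => // [/eqP e|/kr]; last by lia.
  by move: avb; rewrite e; lia.
rewrite in_keys_node; case/or3P: vT => [->//|vl|vr].
  by rewrite IHl ?orbT.
by rewrite IHr ?orbT.
Qed.

Lemma restrict_Leaf a b T :
  {in keys T, forall v, ~~ (a <= v < b)%N} -> restrict a b T = Leaf.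
Proof.
move=> H; apply/keys_eq0/setP => v; rewrite inE; apply/negP => vT.
move: (keys_restrict_bounds vT); apply/negP/H.
exact: (subsetP (keys_restrict_sub a b T) _ vT).
Qed.

Lemma restrict_ubound a b b' T : {in keys T, forall v, v < b /\ v < b'}%N ->
  restrict a b T = restrict a b' T.
Proof.
elim: T => //= l IHl k r IHr H.
have [kb kb'] : (k < b)%N /\ (k < b')%N by apply: H; rewrite !inE eqxx.
by rewrite !(leqNgt _ k) kb kb' IHl ?IHr // => v vT;
  apply: H; rewrite !inE vT ?orbT.
Qed.

Lemma restrict_lbound a a' b T : {in keys T, forall v, a <= v /\ a' <= v}%N ->
  restrict a b T = restrict a' b T.
Proof.
elim: T => //= l IHl k r IHr H.
have [kb kb'] : (a <= k)%N /\ (a' <= k)%N by apply: H; rewrite !inE eqxx.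
by rewrite !ltnNge kb kb' IHl ?IHr // => v vT;
  apply: H; rewrite !inE vT ?orbT.
Qed.

(** The root of a restriction is the lowest common ancestor in [T] of the keys of the interval, as
    the last conclusion records. *)
Lemma restrict_Node T a b l k r : bst T -> restrict a b T = Node l k r ->
  [/\ (a <= k < b)%N, k \in keys T, l = restrict a k T, r = restrict k.+1 b T
    & forall v, v \in keys T -> (a <= v < b)%N -> v \in keys (subtree T k)].
Proof.
elim: T => //= l0 IHl k0 r0 IHr [lk kr bl br].
rewrite !inE; case: (ltnP k0 a) => [k0a /(IHr br)|ak0].
  case=> /andP[ak kb] kT -> -> kd.
  have k0k : (k0 < k)%N by lia.
  have -> : (k == k0) = false by apply/eqP => e; move: k0k; rewrite e ltnn.
  rewrite ak kb kT !orbT (ltnNge k) (ltnW k0k) /= ltnS (ltnW k0k); split=> // v.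
  rewrite !inE => vT av; apply: kd => //.
  by case/or3P: vT => // [/eqP|/lk] e; [move: av; rewrite e|]; lia.
case: (leqP b k0) => [bk0 /(IHl bl)|k0b].
  case=> /andP[ak kb] kT -> -> kd.
  have k0k : (k < k0)%N by lia.
  have -> : (k == k0) = false by apply/eqP => e; move: k0k; rewrite e ltnn.
  rewrite ak kb kT !orbT k0k (ltnW k0k) /= ltnS leqNgt k0k /=.
  split=> // v.
  rewrite !inE => vT av; apply: kd => //.
  by case/or3P: vT => // [/eqP|/kr] e; [move: av; rewrite e|]; lia.
case=> <- <- <-; rewrite eqxx ak0 k0b leqnn /= ltnSn /=; split => //.
- by apply: restrict_ubound => v /lk vk; split=> //; lia.
- by apply: restrict_lbound => v /kr vk; split=> //; lia.
Qed.

(** * Trees whose gaps are filled with restrictions of [A], and caterpillars *)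

Variables (A : tree n) (s : 'I_n).
Hypothesis bA : bst A.

(* [W] is closed upwards in the tree, and what hangs below it is the family of
   restrictions of [A] to the gaps that [W] leaves in the key interval
   [a, b). *)
Inductive gap_filled W : nat -> nat -> tree n -> Prop :=
| GapRestrict a b of (forall w : 'I_n, w \in W -> ~~ (a <= w < b)%N) :
    gap_filled W a b (restrict a b A)
| GapNode a b l k r of k \in W & (a <= k < b)%N & gap_filled W a k l
    & gap_filled W k.+1 b r : gap_filled W a b (Node l k r).

Fixpoint gaps p a b : seq (tree n) :=
  if p is x :: p' then restrict a x A :: gaps p' x.+1 b
  else [:: restrict a b A].

Lemma gaps_cat p x q a b :
  gaps (p ++ x :: q) a b = gaps p a x ++ gaps q x.+1 b.
Proof. by elim: p a => //= y p IH a; rewrite IH. Qed.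

Definition between W a b : seq 'I_n :=
  [seq w <- enum 'I_n | (w \in W) && (a <= w < b)%N].

Lemma mem_between W a b v : (v \in between W a b) = (v \in W) && (a <= v < b)%N.
Proof. by rewrite mem_filter mem_enum andbT. Qed.

Lemma between_cat W a b k : k \in W -> (a <= k < b)%N ->
  between W a b = between W a k ++ k :: between W k.+1 b.
Proof.
move=> kW akb.
have tr : transitive (fun i j : 'I_n => (i < j)%N).
  by move=> j i h; apply: ltn_trans.
have sorted_between a' b' :
    pairwise (fun i j : 'I_n => (i < j)%N) (between W a' b').
  rewrite -sorted_pairwise //; apply: sorted_filter => //.
  have := iota_ltn_sorted 0 n; rewrite -val_enum_ord sorted_map.
  by apply: sub_sorted.
apply: (irr_sorted_eq tr) => [i|||v]; rewrite ?ltnn ?(sorted_pairwise tr) //.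
  rewrite pairwise_cat /= !sorted_between !andbT; apply/andP; split.
    apply/allrelP => i j; rewrite inE !mem_between => /and3P[_ _ ik].
    by case/predU1P=> [-> //|/and3P[_ kj _]]; apply: ltn_trans kj.
  by apply/allP => i; rewrite mem_between => /and3P[].
rewrite mem_cat inE !mem_between -val_eqE /=.
case: eqVneq => [/val_inj ->|]; first by rewrite kW akb orbT.
by move=> nvk; case: (v \in W) => //=; lia.
Qed.

Lemma gap_filled_notin W a b l k r :
  {in W, forall w : 'I_n, ~~ (a <= w < b)%N} -> restrict a b A = Node l k r ->
  k \notin W.
Proof.
by move=> WI /(restrict_Node bA)[akb _ _ _ _]; apply/negP => /WI; rewrite akb.
Qed.

(** The right-hand side does not mention [T]: two gap-filled trees with the same [W] and interval
    have the same hanging subtrees, hence are rearrangements of each other. *)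
Lemma hanging_gap_filled W a b T :
  gap_filled W a b T -> hanging W T = gaps (between W a b) a b.
Proof.
elim=> {a b T} [a b WI | a b l k r kW akb _ IHl _ IHr].
  have -> : between W a b = [::].
    apply/eqP; rewrite -size_eq0 -leqn0 leqNgt -has_predT.
    apply/hasPn => v; rewrite mem_between => /andP[/WI/negP].
    by move=> H /H.
  rewrite /=; case e: (restrict a b A) => [//|l k r] /=.
  by rewrite (negbTE (gap_filled_notin WI e)).
by rewrite /= kW IHl IHr (between_cat kW akb) gaps_cat.
Qed.

Lemma top_gap_filled W a b T : gap_filled W a b T ->
  bst (top W T) /\ keys (top W T) = [set w in between W a b].
Proof.
elim=> {a b T} [a b WI | a b l k r kW akb _ [bl kl] _ [br kr]].
  have -> : top W (restrict a b A) = Leaf.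
    case e: (restrict a b A) => [//|l k r] /=.
    by rewrite (negbTE (gap_filled_notin WI e)).
  split=> //; apply/setP => v; rewrite !inE mem_between.
  by apply/esym/negP => /andP[/WI/negP].
rewrite /= kW; split; last first.
  apply/setP => v; rewrite /= kl kr !inE (between_cat kW akb) mem_cat inE.
  by rewrite orbCA.
split=> // v; rewrite ?kl ?kr inE mem_between => /and3P[] //.
Qed.

(** Induction on the length of the interval. If [W] meets it, the root of the restriction is an
    ancestor in [A] of a key of [W], hence is in [W] by closure; otherwise the whole interval is a
    gap. *)
Lemma gap_filled_restrict W lo hi :
  W \subset keys A ->
  (forall y d, y \in keys A -> d \in W -> (lo <= y < hi)%N ->
     (lo <= d < hi)%N -> d \in keys (subtree A y) -> y \in W) ->
  forall a b, (lo <= a)%N -> (b <= hi)%N -> gap_filled W a b (restrict a b A).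
Proof.
move=> WA Wcl a b; have [m] := ubnP (b - a).
elim: m a b => // m IH a b abm la bh.
have [/existsP[d /andP[dW adb]]|/existsPn WI] :=
    boolP [exists d, (d \in W) && (a <= d < b)%N]; last first.
  by apply: GapRestrict => w wW; have := WI w; rewrite wW.
case e: (restrict a b A) => [|l k r].
  by have := mem_keys_restrict bA (subsetP WA _ dW) adb; rewrite e inE.
have [akb kA -> -> kd] := restrict_Node bA e.
apply: GapNode => //; first 1 last.
- by apply: IH; lia.
- by apply: IH; lia.
by apply: (Wcl k d) => //; [lia|lia|apply: kd; rewrite ?(subsetP WA)].
Qed.

(** The intermediate trees of the decomposition: [p] is the current path above [s], and the side
    trees are taken from [A]. *)
Fixpoint caterpillar p a b : tree n :=
  if p is x :: p' then
    if (s < x)%N then Node (caterpillar p' a x) x (restrict x.+1 b A)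
    else Node (restrict a x A) x (caterpillar p' x.+1 b)
  else Node (restrict a s A) s (restrict s.+1 b A).

(* [p] followed by [s] can be the search path of [s] in a BST with keys in
   [a, b). *)
Fixpoint narrowing p a b : bool :=
  if p is x :: p' then
    [&& (a <= x < b)%N, x != s
      & if (s < x)%N then narrowing p' a x else narrowing p' x.+1 b]
  else (a <= s < b)%N.

Lemma narrowing_bounds p a b : narrowing p a b ->
  {in s :: p, forall v, (a <= v < b)%N}.
Proof.
elim: p a b => [|x p IH] a b /=; first by move=> ? v; rewrite inE => /eqP->.
by case/and3P => axb _; case: ifP => _ /IH H v; rewrite !inE;
  have Hs := H s (mem_head _ _);
  case/or3P => [/eqP->|/eqP->|vp]; try lia;
  have := H v; rewrite inE vp orbT => /(_ isT); lia.
Qed.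

Lemma narrowing_widen p a b a' b' : (a' <= a)%N -> (b <= b')%N ->
  narrowing p a b -> narrowing p a' b'.
Proof.
elim: p a b a' b' => [|x p IH] a b a' b' aa bb /=; first by lia.
case/and3P => axb ->; have -> /= : (a' <= x < b')%N by lia.
by case: ifP => _; apply: IH.
Qed.

(** Deleting a node of a search path only relaxes the bounds on the nodes below it. *)
Lemma narrowing_filter P p a b : narrowing p a b -> narrowing (filter P p) a b.
Proof.
elim: p a b => [|x p IH] a b //= /and3P[axb nxs].
case: (P x) => /=; first by rewrite axb nxs /=; case: ifP => _; apply: IH.
by case: ifP => _ /IH; apply: narrowing_widen => //; lia.
Qed.

Lemma narrowing_search_path T a b : bst T -> s \in keys T ->
  {in keys T, forall v, (a <= v < b)%N} -> narrowing (search_path T s) a b.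
Proof.
elim: T a b => [|l IHl k r IHr] a b; first by rewrite inE.
case=> lk kr bl br; rewrite in_keys_node => sT H /=.
have H' v : [|| v == k, v \in keys l | v \in keys r] -> (a <= v < b)%N.
  by rewrite -in_keys_node; apply: H.
have akb : (a <= k < b)%N by apply: H'; rewrite eqxx.
case: eqVneq sT => [e _|nsk /=]; first by rewrite /= e.
have [sk|ks|/val_inj/eqP] := ltngtP s k; last by rewrite (negbTE nsk).
  move=> sT; rewrite /= akb eq_sym nsk sk /=; apply: IHl => //.
    by case/orP: sT => // /kr; lia.
  by move=> v vl; have := H' v; rewrite (lk _ vl) vl orbT => /(_ isT); lia.
move=> sT; rewrite /= akb eq_sym nsk ltnNge (ltnW ks) /=; apply: IHr => //.
  by case/orP: sT => // /lk; lia.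
by move=> v vl; have := H' v; rewrite (kr _ vl) vl !orbT => /(_ isT); lia.
Qed.

(** Every key of [A] in the interval lies on the path, so the restrictions of [A] to the gaps
    between path keys are all empty. *)
Lemma before_path_caterpillar T a b : bst T -> s \in keys T ->
  {in keys T, forall v, (a <= v < b)%N} ->
  (forall v, v \in keys A -> (a <= v < b)%N ->
     v \in keys (before_path T s)) ->
  before_path T s = caterpillar (search_path T s) a b.
Proof.
elim: T a b => [|l IHl k r IHr] a b; first by rewrite inE.
case=> lk kr bl br; rewrite in_keys_node => sT H /=.
have H' v : [|| v == k, v \in keys l | v \in keys r] -> (a <= v < b)%N.
  by rewrite -in_keys_node; apply: H.
have akb : (a <= k < b)%N by apply: H'; rewrite eqxx.
case: eqVneq sT => [e _ HA|nsk /=].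
  rewrite /= e !restrict_Leaf // => v vA; apply/negP => avb;
  by have := HA v vA; rewrite !inE orbF -val_eqE /=; lia.
have [sk|ks|/val_inj/eqP] := ltngtP s k; last by rewrite (negbTE nsk).
  move=> sT HA; rewrite /= sk (@IHl a k) //.
  - rewrite restrict_Leaf // => v vA; apply/negP => avb.
    have := HA v vA; rewrite in_keys_node inE orbF -val_eqE /=.
    move=> /(_ ltac:(lia)) /orP[|/(subsetP (keys_before_path_sub _ _))/lk]; lia.
  - by case/orP: sT => // /kr; lia.
  - by move=> v vl; have := H' v; rewrite (lk _ vl) vl orbT => /(_ isT); lia.
  move=> v vA avk; have := HA v vA; rewrite in_keys_node inE orbF -val_eqE /=.
  by move=> /(_ ltac:(lia)) /orP[|//]; lia.
move=> sT HA; rewrite /= ltnNge (ltnW ks) /= (@IHr k.+1 b) //.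
- rewrite restrict_Leaf // => v vA; apply/negP => avb.
  have := HA v vA; rewrite in_keys_node inE -val_eqE /=.
  move=> /(_ ltac:(lia)) /orP[|/(subsetP (keys_before_path_sub _ _))/kr]; lia.
- by case/orP: sT => // /lk; lia.
- by move=> v vl; have := H' v; rewrite (kr _ vl) vl !orbT => /(_ isT); lia.
move=> v vA avk; have := HA v vA; rewrite in_keys_node inE -val_eqE /=.
by move=> /(_ ltac:(lia)) /orP[|//]; lia.
Qed.

Lemma root_path_caterpillar p a b : root_path (caterpillar p a b) (rcons p s).
Proof.
by elim: p a b => [|x p IH] a b /=; rewrite ?eqxx //; case: ifP => _;
  rewrite /= eqxx IH ?orbT.
Qed.

Lemma gap_filled_caterpillar W p lo hi : s \in W -> {subset p <= W} ->
  narrowing p lo hi ->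
  (forall a b, (lo <= a)%N -> (b <= hi)%N ->
     gap_filled W a b (restrict a b A)) ->
  gap_filled W lo hi (caterpillar p lo hi).
Proof.
move=> sW; elim: p lo hi => [|x p IH] lo hi pW /=.
  by move=> ls H; apply: GapNode => //; apply: H; lia.
have xW : x \in W by apply: pW; rewrite inE eqxx.
have {}pW : {subset p <= W} by move=> v vp; apply: pW; rewrite inE vp orbT.
case/and3P=> lx _; case: ifP => _ np H; apply: GapNode => //;
  by [apply: H; lia | apply: IH => // a b ? ?; apply: H; lia].
Qed.

Lemma rearrange_id W B T : [disjoint keys T & W] -> rearrange W B T = T.
Proof.
elim: T => //= l IHl k r IHr; rewrite -setI_eq0 !setIUl !setU_eq0 !setI_eq0.
rewrite disjoints1; case/and3P=> /negbTE -> /IHl -> /IHr -> //.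
Qed.

(** Descending along [U] narrows [[a, b)] to [[a', b')]. A rearrangement of keys in [[a', b')] meets
    neither [U] nor the trees hanging beside it, so it can be carried out below [U]. *)
Lemma caterpillar_cat U p a b : narrowing (U ++ p) a b ->
  exists a' b', [/\ narrowing p a' b', {in U, forall v, ~~ (a' <= v < b')%N},
    (a <= a')%N, (b' <= b)%N &
    (forall q, down_path (caterpillar p a' b') q ->
       down_path (caterpillar (U ++ p) a b) q) /\
    forall W B p', {in W, forall v, (a' <= v < b')%N} ->
      rearrange W B (caterpillar p a' b') = caterpillar p' a' b' ->
      rearrange W B (caterpillar (U ++ p) a b) = caterpillar (U ++ p') a b].
Proof.
elim: U a b => [|x U IH] a b /=; first by exists a, b; split.
case/and3P=> axb nxs; case: ifP => sx /IH[a' [b' [np Uo aa' b'b [dp rp]]]].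
  exists a', b'; split=> //; try lia.
    move=> v; rewrite inE => /predU1P[->|/Uo //]; lia.
  split=> [q /dp dq|W B p' WI /(rp _ _ _ WI) e].
    by rewrite /= dq orbT.
  have xW : (x \in W) = false by apply/negP => /WI; lia.
rewrite /= xW.
  rewrite e rearrange_id //; apply/pred0P => v /=; apply/negP => /andP[].
  by move/keys_restrict_bounds => + /WI; lia.
exists a', b'; split=> //; try lia.
  move=> v; rewrite inE => /predU1P[->|/Uo //]; lia.
split=> [q /dp dq|W B p' WI /(rp _ _ _ WI) e].
  by rewrite /= dq !orbT.
have xW : (x \in W) = false by apply/negP => /WI; lia.
rewrite /= xW.
rewrite e rearrange_id //; apply/pred0P => v /=; apply/negP => /andP[].
by move/keys_restrict_bounds => + /WI; lia.
Qed.

End Local.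

(** * The windows and the decomposition they define *)

Section Windows.
Variables (n : nat) (A : tree n) (s : 'I_n) (ps : seq 'I_n).
Implicit Types (v x y d e : 'I_n) (U p : seq 'I_n).

(** Ancestors are taken in the after-tree, and each key of [A] is its own ancestor. *)
Definition ancestor_of U v : bool := has (fun e => e \in keys (subtree A v)) U.

(** The path above [s] when the first [i] nodes of the search path remain to be visited. *)
Definition pending i : seq 'I_n := [seq v <- ps | ancestor_of (take i ps) v].

Definition window i j : {set 'I_n} :=
  s |: [set v in drop i ps | ancestor_of (take j ps) v].

Lemma ancestor_of_sub U U' v :
  {subset U <= U'} -> ancestor_of U v -> ancestor_of U' v.
Proof. by move=> UU' /hasP[e /UU' eU' ev]; apply/hasP; exists e. Qed.

Lemma mem_window i j v :
  (v \in window i j) =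
  (v == s) || ((v \in drop i ps) && ancestor_of (take j ps) v).
Proof. by rewrite !inE. Qed.

Hypotheses (bA : bst A) (rA : Defs.root A = Some s).
Hypotheses (kA : keys A = s |: [set v in ps]) (nps : narrowing s ps 0 n).

Lemma mem_take_sub i j : (i <= j)%N -> {subset take i ps <= take j ps}.
Proof.
by move=> ij v; rewrite -(subnKC ij) takeD mem_cat => ->.
Qed.

Lemma mem_drop_sub i j : (i <= j)%N -> {subset drop j ps <= drop i ps}.
Proof.
move=> ij v; rewrite -(cat_take_drop (j - i) (drop i ps)) drop_drop subnK //.
by rewrite mem_cat => ->; rewrite orbT.
Qed.

(** The nodes of [take i ps] pass the filter as their own ancestors. This splits the path into a
    fixed upper part and the nodes of the window other than [s]. *)
Lemma take_pending i j : (i <= j)%N ->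
  pending j = take i ps ++ [seq v <- drop i ps | ancestor_of (take j ps) v].
Proof.
move=> ij.
have -> : pending j =
    [seq v <- take i ps ++ drop i ps | ancestor_of (take j ps) v].
  by rewrite cat_take_drop.
rewrite filter_cat; congr cat.
apply/all_filterP/allP => v vi; apply/hasP; exists v.
  exact: mem_take_sub vi.
by apply: mem_keys_subtree => //; rewrite kA !inE (mem_take vi) orbT.
Qed.

(** Closure of [W] under ancestors makes both caterpillars gap-filled for the same [W], so they
    share their hanging subtrees; the tree to put on [W] is read off the target. *)
Lemma top_rearrange W p p' a b : narrowing s p a b -> narrowing s p' a b ->
  W = s |: [set v in p] -> {subset p' <= p} ->
  (forall y d, y \in keys A -> d \in W -> (a <= y < b)%N ->
     (a <= d < b)%N -> d \in keys (subtree A y) -> y \in W) ->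
  W \subset keys A ->
  let B := top W (caterpillar A s p' a b) in
  bst_on W B /\
  rearrange W B (caterpillar A s p a b) = caterpillar A s p' a b.
Proof.
move=> np np' eW p'p Wcl WA B.
have sW : s \in W by rewrite eW !inE eqxx.
have pW : {subset p <= W} by move=> v vp; rewrite eW !inE vp orbT.
have gI := gap_filled_restrict bA WA Wcl.
have g := gap_filled_caterpillar sW pW np gI.
have g' := gap_filled_caterpillar sW (fun v vp => pW v (p'p v vp)) np' gI.
split.
  have [bB kB] := top_gap_filled bA g'; split=> //; rewrite kB.
  apply/setP => v; rewrite inE mem_between; case vW: (v \in W) => //=.
  apply: (narrowing_bounds np); move: vW; rewrite eW !inE; by case: eqP.
have [k rk kW] :
    exists2 k, Defs.root (caterpillar A s p a b) = Some k & k \in W.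
  case: (p) pW => [|x q] pW /=; first by exists s.
  by exists x; [case: ifP | apply: pW; rewrite inE eqxx].
rewrite (rearrange_root _ rk kW) (hanging_gap_filled bA g).
by rewrite -(hanging_gap_filled bA g') fill_top.
Qed.

Lemma caterpillar_step i j : (i <= j)%N ->
  path_rearrangement (window i j) (caterpillar A s (pending j) 0 n)
    (caterpillar A s (pending i) 0 n).
Proof.
move=> ij; set l := [seq v <- drop i ps | ancestor_of (take j ps) v].
set l' := [seq v <- drop i ps | ancestor_of (take i ps) v].
have el' : l' = filter (ancestor_of (take i ps)) l.
  rewrite /l /l' -filter_predI; apply: eq_filter => v /=.
  case va: (ancestor_of (take i ps) v) => //=.
  by rewrite (ancestor_of_sub _ va) //; apply: mem_take_sub.
have np : narrowing s (take i ps ++ l) 0 n.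
  by rewrite -take_pending //; apply: narrowing_filter.
rewrite (take_pending ij) (take_pending (leqnn i)) -/l -/l'.
have [a [b [nl Uo _ _ [dp re]]]] := caterpillar_cat A np.
have eW : window i j = s |: [set v in l].
  by apply/setP => v; rewrite !inE mem_filter andbC.
have nl' : narrowing s l' a b by rewrite el' narrowing_filter.
have l'l : {subset l' <= l} by rewrite el'; apply/mem_subseq/filter_subseq.
have WA : window i j \subset keys A.
  apply/subsetP => v; rewrite mem_window kA !inE.
  case/orP=> [->//|/andP[/mem_drop -> _]]; by rewrite orbT.
(* Keys of [[a, b)] avoid [take i ps], so [y] is [s] or lies in [drop i ps]. If [d] is [s], the root
   of [A], its only ancestor is itself; otherwise ancestry is transitive. *)
have Wcl y d : y \in keys A -> d \in window i j -> (a <= y < b)%N ->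
    (a <= d < b)%N -> d \in keys (subtree A y) -> y \in window i j.
  rewrite {1}kA !mem_window !inE; case: eqP => //= nys yps + yab _ dy.
  have yi : y \in drop i ps.
    have : y \in take i ps ++ drop i ps by rewrite cat_take_drop.
    by rewrite mem_cat => /orP[/Uo|//]; rewrite yab.
  rewrite yi /=; case/predU1P=> [eds|/andP[_ /hasP[e ej ed]]].
    move: dy; rewrite eds; case: (A) rA bA => //= l0 k r [->] [lk kr _ _].
    rewrite (introF eqP nys); case: ifP => _ /(subsetP (keys_subtree_sub _ _)).
      by move/lk; rewrite ltnn.
    by move/kr; rewrite ltnn.
  by apply/hasP; exists e => //; apply: mem_keys_subtree_trans dy ed.
have [bB eB] := top_rearrange nl nl' eW l'l Wcl WA.
split.
  exists (rcons l s).
    apply: dp; move: (root_path_caterpillar A s l a b).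
    by case: (caterpillar _ _ _ _ _) => //= ? ? ? ->.
  by apply/setP => v; rewrite eW !inE mem_rcons inE.
eexists; first exact: bB.
rewrite (re _ _ l') //.
by move=> v vW; apply: (narrowing_bounds nl); move: vW; rewrite eW !inE.
Qed.

Lemma narrowing_uniq p a b : narrowing s p a b -> uniq p.
Proof.
elim: p a b => //= x p IH a b /and3P[_ _]; case: ifP => _ nx;
  rewrite (IH _ _ nx) andbT; apply/negP => xp;
  by have := narrowing_bounds nx (@mem_behead _ (s :: p) _ xp);
    rewrite ltnn ?andbF.
Qed.

Lemma narrowing_neq p a b : narrowing s p a b -> {in p, forall v, v != s}.
Proof.
elim: p a b => //= x p IH a b /and3P[_ xs np] v; rewrite inE.
by case/predU1P=> [->//|]; case: ifP np => _ /IH; apply.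
Qed.

Lemma pending0 : pending 0 = [::].
Proof. by rewrite /pending take0; elim: ps. Qed.

Lemma pending_size : pending (size ps) = ps.
Proof. by rewrite (take_pending (leqnn _)) drop_size take_size cats0. Qed.

(** As [s] is the root of [A], the two restrictions are the left and right subtrees. *)
Lemma caterpillar_nil : caterpillar A s [::] 0 n = A.
Proof.
case: (A) rA bA => //= l k r [->] [lk kr _ _].
rewrite leqnn ltnSn.
congr Node; apply: restrict_id => v; first by move/lk->.
by move/kr->; rewrite ltn_ord.
Qed.

Lemma windows_decomposition m P :
  P = caterpillar A s ps 0 n ->
  (0 < m)%N -> (forall i, (i < size ps)%N -> (#|window i i.+1| <= m)%N) ->
  local_decomposition m s P A.
Proof.
move=> eP m0 Hm; set N := size ps.
(* Step 0 has window [{s}] and changes nothing; it provides a first path even when [ps] is empty.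
   Step [i > 0] visits the node at position [N - i]. *)
exists N.+1, (fun i => caterpillar A s (pending (N.+1 - i)) 0 n),
  (fun i => window (N - i) (N.+1 - i)).
have pendN : pending N.+1 = ps.
  by rewrite -[RHS]pending_size /pending take_size take_oversize.
split; split=> //.
- by rewrite subn0 pendN.
- by rewrite subnn pending0 caterpillar_nil.
- by move=> i iN; rewrite subSS; apply: caterpillar_step; lia.
- by rewrite mem_window eqxx.
- move=> i iN; apply/set0Pn.
  have jN : (N - i.+1 < size ps)%N by rewrite -/N; lia.
  (* The newly visited node: it is its own ancestor, and it is absent from [drop (N - i) ps] because
     [ps] has no repetition. *)
  exists (nth s ps (N - i.+1)); rewrite subSS inE !mem_window.
  set x := nth _ _ _.
  have xps : x \in ps by rewrite mem_nth.
  have eNi : (N - i = (N - i.+1).+1)%N by lia.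
  have xd : x \in drop (N - i.+1) ps by rewrite (drop_nth s) // inE eqxx.
  have xt : x \in take (N - i) ps.
    by rewrite eNi (take_nth s) // mem_rcons inE eqxx.
  have xs : x != s by apply: narrowing_neq nps _ xps.
  have xd' : x \notin drop (N - i) ps.
    have := narrowing_uniq nps; rewrite -{1}(cat_take_drop (N - i) ps) cat_uniq.
    by case/and3P=> _ /hasPn H _; apply/negP => /H; rewrite xt.
  rewrite (negbTE xs) (negbTE xd') xd /=; apply/hasP; exists x => //.
  by apply: mem_keys_subtree => //; rewrite kA !inE xps orbT.
- by move=> i _; apply/set0Pn; exists s; rewrite inE !mem_window eqxx.
(* A node that leaves the window has no descendant in [A] among [take (N - i) ps], whereas [p j]
   would require one in a prefix that is no longer. *)
- move=> i j ij jN; apply/setP => v; rewrite !inE.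
  apply/negP; rewrite !subSS; case: (v == s) => //=.
  case/andP=> /andP[nv /andP[vd va]] /andP[_ vj].
  move: nv; rewrite (mem_drop_sub _ vd) /=; last lia.
  rewrite (ancestor_of_sub _ vj) //; apply: mem_take_sub; lia.
move=> i iN; case: (posnP i) => [->|i0].
  rewrite !subn0 (_ : window _ _ = [set s]) ?cards1 //.
  by apply/setP => v; rewrite mem_window drop_size inE orbF.
have -> : (N.+1 - i = (N - i).+1)%N by lia.
by apply: Hm; rewrite -/N; lia.
Qed.

End Windows.

(** * Bounding the windows by the access lemma *)

Section Access.
Local Open Scope ring_scope.
Variable R : realType.

Lemma log2M (x y : R) : 0 < x -> 0 < y -> log2 (x * y) = log2 x + log2 y.
Proof. by move=> x0 y0; rewrite /log2 lnM ?posrE // mulrDl. Qed.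

Lemma ler_log2 (x y : R) : 0 < x -> x <= y -> log2 x <= log2 y.
Proof.
move=> x0 xy; rewrite /log2 ler_wpM2r ?invr_ge0 ?ln_ge0 ?ler1n //.
by rewrite ler_ln ?posrE // (lt_le_trans x0).
Qed.

Lemma log2_ge0 (x : R) : 1 <= x -> 0 <= log2 x.
Proof.
by move=> x1; rewrite /log2 mulr_ge0 ?invr_ge0 ?ln_ge0 // ler1n.
Qed.

Lemma log2_onto (y : R) : exists2 x : R, 0 < x & log2 x = y.
Proof.
exists (expR (y * ln 2)); first exact: expR_gt0.
by rewrite /log2 expRK mulfK // gt_eqF // ln_gt0 // ltr1n.
Qed.

Lemma weight_ge (n : nat) (w : 'I_n -> R) (S : {set 'I_n}) a :
  (forall v, 0 < w v) -> a \in S -> w a <= weight w S.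
Proof.
move=> w0 aS; rewrite /weight (bigD1 a) //= lerDl.
by apply: sumr_ge0 => v _; apply: ltW.
Qed.

Lemma weight_le (n : nat) (w : 'I_n -> R) (S : {set 'I_n}) M :
  0 <= M -> (forall v, v \in S -> w v <= M) -> weight w S <= n%:R * M.
Proof.
move=> M0 wM; apply: le_trans (ler_sum _ wM) _.
rewrite sumr_const -[M *+ _]mulr_natl ler_wpM2r // ler_nat.
by rewrite -[X in (_ <= X)%N](card_ord n) max_card.
Qed.

(** The tree, [s] and [A] are fixed while the weights vary. The absolute value is there because the
    sign of [c] is unknown. *)
Lemma access_crossing_bound (c : R) (n : nat)
    (T : tree n) (s : 'I_n) (A : tree n) (C : {set 'I_n}) :
  (forall w : 'I_n -> R, (forall a, 0 < w a) ->
     #|keys (before_path T s)|%:R <=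
       sol_potential w T - sol_potential w (new_tree T s A)
       + c * (1 + log2 (weight w [set: 'I_n] / w s))) ->
  bst_on [set: 'I_n] T -> bst_on (keys (before_path T s)) A ->
  s \in C -> {in C, forall v, keys (subtree T v) \subset C} ->
  #|[set v in C | ~~ (keys (subtree A v) \subset C)]|%:R <= `|c|.
Proof.
move=> access [bT kT] bA sC closedC; set D := [set v in C | _].
have sT : s \in keys T by rewrite kT inE.
have [bT' kT'] := new_tree_bst bT sT bA.
set T' := new_tree T s A in bT' kT' access.
have n0 : 0 < n%:R :> R by rewrite ltr0n (leq_ltn_trans _ (ltn_ord s)).
have n1 : 1 <= n%:R :> R by rewrite ler1n -(ltr0n R).
have lgn0 := log2_ge0 n1.
have c0 := normr_ge0 c; have cc := ler_norm c.
rewrite leNgt; apply/negP; set d : R := #|D|%:R => cd.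
(* [K] collects the terms of the upper bound that do not depend on [N]. The choice of [N] below
   gives [(d - |c|) * log2 N = K + 1], so the right-hand side of the access inequality is at most
   -1, below any cardinal. *)
set K := n%:R * log2 n%:R + `|c| * (1 + log2 n%:R).
have K0 : 0 <= K.
  by apply: addr_ge0; apply: mulr_ge0 => //; apply: addr_ge0.
have dc0 : 0 < d - `|c| by rewrite subr_gt0.
have [N N0 lgN] := log2_onto ((K + 1) / (d - `|c|)).
have lgN0 : 0 < log2 N by rewrite lgN divr_gt0 // ltr_wpDl.
have N1 : 1 <= N.
  rewrite leNgt; apply/negP => N1; move: lgN0; rewrite ltNge => /negP; apply.
  by apply: le_trans (ler_log2 N0 (ltW N1)) _; rewrite /log2 ln1 mul0r.
pose w v : R := if v \in C then 1 else N.
have w0 v : 0 < w v by rewrite /w; case: ifP.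
have wN v : w v <= N by rewrite /w; case: ifP.
have ws : w s = 1 by rewrite /w sC.
have W_le : weight w [set: 'I_n] <= n%:R * N.
  by apply: weight_le => //; apply: ltW.
have W_ge : 1 <= weight w [set: 'I_n] by rewrite -ws; apply: weight_ge.
(* Outside [C], the weight is at most [n * N] before and at least [N] after. In [C] it is at most
   [n] before, and after it is at least [N] on [D] and at least 1 elsewhere. *)
have potential v : log2 (weight w (keys (subtree T v)))
    - log2 (weight w (keys (subtree T' v)))
    <= log2 n%:R - (v \in D)%:R * log2 N.
  have vT : v \in keys (subtree T v) by rewrite mem_keys_subtree ?kT ?inE.
  have vT' : v \in keys (subtree T' v).
    by rewrite mem_keys_subtree ?kT' ?kT ?inE.
  have tv0 := lt_le_trans (w0 v) (weight_ge w0 vT).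
  have tv'0 := lt_le_trans (w0 v) (weight_ge w0 vT').
  have w1 u : 1 <= w u by rewrite /w; case: ifP.
  have lgT : log2 (weight w (keys (subtree T v))) <=
      log2 n%:R + (v \notin C)%:R * log2 N.
    case: (boolP (v \in C)) => vC; rewrite ?mul0r ?addr0 ?mul1r /=.
      apply: ler_log2 => //; rewrite -[leRHS]mulr1; apply: weight_le => // u.
      by move/(subsetP (closedC v vC)) => uC; rewrite /w uC.
    rewrite -log2M //; apply: ler_log2 => //.
    by apply: weight_le => //; apply: ltW.
  have lgT' : ((v \notin C) || (v \in D))%:R * log2 N <=
      log2 (weight w (keys (subtree T' v))).
    case: (boolP (_ || _)) => [vCD|_]; last first.
      by rewrite mul0r log2_ge0 // (le_trans (w1 v)) // weight_ge.
    rewrite mul1r; apply: ler_log2 => //.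
    case/orP: vCD => [vC|].
      by rewrite (le_trans _ (weight_ge w0 vT')) // /w (negbTE vC).
    rewrite inE => /andP[_ /subsetPn[u uA uC]].
    have uT' : u \in keys (subtree T' v).
      by rewrite /T' new_treeE //; apply: (subsetP (keys_subtree_fill _ _ _)).
    by rewrite (le_trans _ (weight_ge w0 uT')) // /w (negbTE uC).
  move: lgT lgT'; rewrite [v \in D]inE.
  by case: (v \in C); case: (_ \subset _) => /=; lra.
have dPhi : sol_potential w T - sol_potential w T'
    <= n%:R * log2 n%:R - d * log2 N.
  rewrite /sol_potential -sumrB.
  apply: le_trans (ler_sum _ (fun v _ => potential v)) _.
  rewrite sumrB sumr_const card_ord -[log2 _ *+ _]mulr_natl -mulr_suml.
  rewrite lerD2l lerN2 ler_wpM2r ?(ltW lgN0) //.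
  by rewrite -natr_sum -big_mkcond /= sum1_card.
have logW : 0 <= 1 + log2 (weight w [set: 'I_n] / w s)
    <= 1 + (log2 n%:R + log2 N).
  rewrite ws divr1 addr_ge0 ?log2_ge0 //= lerD2l -log2M //.
  by apply: ler_log2 => //; apply: lt_le_trans W_ge.
have /andP[logW0 logW1] := logW.
have := access w w0; rewrite leNgt => /negP; apply.
apply: lt_le_trans (ler0n _ _).
have cW : c * (1 + log2 (weight w [set: 'I_n] / w s)) <=
    `|c| * (1 + (log2 n%:R + log2 N)).
  by apply: le_trans (ler_wpM2r logW0 cc) _; apply: ler_wpM2l.
have : (d - `|c|) * log2 N = K + 1 by rewrite lgN mulrC divfK // gt_eqF.
rewrite /K; move: dPhi cW; lra.
Qed.

Lemma card_window_le (c : R) (n : nat)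
    (T : tree n) (s : 'I_n) (A : tree n) i :
  (forall w : 'I_n -> R, (forall a, 0 < w a) ->
     #|keys (before_path T s)|%:R <=
       sol_potential w T - sol_potential w (new_tree T s A)
       + c * (1 + log2 (weight w [set: 'I_n] / w s))) ->
  bst_on [set: 'I_n] T -> bst_on (keys (before_path T s)) A ->
  Defs.root A = Some s ->
  (i < size (search_path T s))%N ->
  (#|window A s (search_path T s) i i.+1| <= (Num.truncn `|c|).+1)%N.
Proof.
move=> access bT bA rA iN.
have sT : s \in keys T by rewrite bT.2 inE.
(* The cut is at [i.+1], so the node [x] at position [i] stays outside [C]; it accounts for the
   extra 1 in the bound. *)
have [C [_ sC closedC tC dC]] := search_path_cut bT.1 sT iN.
have := access_crossing_bound access bT bA sC closedC.
set D := [set v in C | _] => cD.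
have {cD}cD : (#|D| <= Num.truncn `|c|)%N by rewrite truncn_ge_nat.
have kA : keys A = s |: [set v in search_path T s].
  by rewrite bA.2 (keys_before_path sT bT.1).
set x := nth s (search_path T s) i.
have xt : x \in take i.+1 (search_path T s).
  by rewrite (take_nth s) // mem_rcons inE eqxx.
apply: leq_trans (_ : #|x |: D| <= _)%N; last first.
  by rewrite cardsU1 -add1n leq_add // leq_b1.
apply/subset_leq_card/subsetP => v; rewrite mem_window in_setU1 inE.
(* As root of [A], [s] has [x] in its subtree, so it crosses out of [C]; any other window node
   except [x] has a descendant in [take i.+1], also outside [C]. *)
case/predU1P=> [->|].
  rewrite sC /=; apply/orP; right; apply/subsetPn; exists x; last exact: tC.
  have xA : x \in keys A by rewrite kA !inE (mem_take xt) orbT.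
  by case: (A) rA xA => //= l k r [->]; rewrite eqxx.
rewrite (drop_nth s) // inE => /andP[/predU1P[->|vd] /hasP[e et ev]].
  by rewrite eqxx.
rewrite (dC v vd) /=; apply/orP; right; apply/subsetPn; exists e => //.
exact: tC.
Qed.

End Access.

Theorem theorem3 (R : realType) (alg : msa_algorithm) :
  access_lemma R alg -> local alg.
Proof.
(* At most [|c|] crossing nodes, plus the newly visited one. *)
case=> c access; exists (Num.truncn `|c|%R).+1 => n T s A bT step.
have [bA rA] := step_after_tree bT step.
have sT : s \in keys T by rewrite bT.2 inE.
have kA : keys A = s |: [set v in search_path T s].
  by rewrite bA.2 (keys_before_path sT bT.1).
have bounds (v : 'I_n) : v \in keys T -> (0 <= v < n)%N by rewrite ltn_ord.
have nps := narrowing_search_path bT.1 sT bounds.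
apply: (windows_decomposition bA.1 rA kA nps) => //.
  apply: before_path_caterpillar bT.1 sT bounds _ => v vA _.
  by rewrite -bA.2.
move=> i iN; apply: (card_window_le _ bT bA rA iN) => w w0.
exact: access.
Qed.
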